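(* Let $\alpha>0$ and $R>0$, and suppose that $$\rho>\frac{\sqrt{4\alpha^2R^2+6-2\sqrt{4\alpha^2R^2+9}}}{\alpha}.$$ Then $f(\omega^m)>0$ for every $N\in\mathbb N$ and every $m=0,\dots,N-1$, where $\omega=e^{2\pi i/N}$ and $f(\omega^m)=\sum_{l=0}^{N-1}c_l\,\omega^{ml}$. Consequently, the approximate solution $g_N$ is determined uniquely, i.e. there is exactly one choice of coefficients $Q_1,\dots,Q_N$ such that $g_N(x)=\sum_{k=1}^NQ_kK_0(\alpha|x-y_k|)$ satisfies $\frac{\partial g_N}{\partial n}(x_j)=s(x_j)$ for $j=1,\dots,N$.
   Context: $\mathbb N=\{1,2,\dots\}$; $\mathbb R^2$ is identified with $\mathbb C$; $\Omega=B(0,R)\subset\mathbb R^2$ is the open disk of radius $R$ centred at the origin; $0<R<\rho$ throughout; $\partial/\partial n$ is the outward normal derivative on $\partial\Omega$; $s$ is a given sufficiently smooth function on $\partial\Omega$. $K_\nu$ denotes the modified Bessel function of the second kind of order $\nu$. For $N\in\mathbb N$, put $\omega=e^{2\pi i/N}$, charge points $y_k=\rho\,\omega^k$ ($k=1,\dots,N$), collocation points $x_j=R\,\omega^j$ ($j=1,\dots,N$), $\theta_l=2\pi l/N$, and $$c_l=-\alpha K_1\big(\alpha|R-\rho e^{-i\theta_l}|\big)\frac{R-\rho\cos\theta_l}{|R-\rho e^{-i\theta_l}|},\qquad l\in\mathbb Z .$$ The quantity $c_{j-k}$ is the normal derivative at $x_j$ of $x\mapsto K_0(\alpha|x-y_k|)$,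 so the conditions $\frac{\partial g_N}{\partial n}(x_j)=s(x_j)$ form an $N\times N$ linear system for $(Q_k)$ with cyclic (circulant) matrix with first row $(c_0,\dots,c_{N-1})$, whose eigenvalues are $f(\omega^m)$, $m=0,\dots,N-1$. *)

(* Defs.v *)
From HB Require Import structures.
From mathcomp Require Import all_boot all_order all_algebra.
From mathcomp Require Import all_classical all_reals all_analysis.
From mathcomp Require Import complex.

Set Implicit Arguments.
Unset Strict Implicit.
Unset Printing Implicit Defensive.

Import Order.TTheory GRing.Theory Num.Theory.
Import numFieldNormedType.Exports.

Local Open Scope classical_set_scope.
Local Open Scope ring_scope.
Local Open Scope complex_scope.

(* [normc z : R] is the real-valued modulus; [`|z|] is the same number seen
   in R[i]. *)
Notation normc := ComplexField.Normc.normc.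

Section Defs.
Context {R : realType}.

Definition coshR (t : R) : R := (expR t + expR (- t)) / 2.

(* Modified Bessel function of the second kind of real order nu, through
   Schlaefli's integral
     K_nu(x) = \int_0^oo exp(-x cosh t) cosh(nu t) dt.
   Only meaningful for x > 0: for x <= 0 the integral diverges and the value
   is the default of [Rintegral]. *)
Definition besselK (nu x : R) : R :=
  \int[lebesgue_measure]_(t in `[0, +oo[)
    (expR (- (x * coshR t)) * coshR (nu * t)).

(* e^{i t} *)
Definition expi (t : R) : R[i] := cos t +i* sin t.

Definition theta (N : nat) (l : int) : R := 2 * pi * l%:~R / N%:R.

Definition omega (N : nat) : R[i] := expi (2 * pi / N%:R).

Definition charge_pt (rho : R) (N k : nat) : R[i] := rho%:C * omega N ^+ k.

Definition colloc_pt (r : R) (N j : nat) : R[i] := r%:C * omega N ^+ j.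

Definition c (alpha r rho : R) (N : nat) (l : int) : R :=
  let d := normc (r%:C - rho%:C * expi (- theta N l)) in
  - alpha * besselK 1 (alpha * d) * ((r - rho * cos (theta N l)) / d).

Definition f (alpha r rho : R) (N : nat) (z : R[i]) : R[i] :=
  \sum_(0 <= l < N) (c alpha r rho N l)%:C * z ^+ l.

(* The coefficient attached to the (k+1)-st charge point is the entry of Q
   with 0-based index k. *)
Definition approx_sol (alpha rho : R) (N : nat) (Q : 'rV[R]_N) (x : R[i]) : R :=
  \sum_(k < N) Q 0 k * besselK 0 (alpha * normc (x - charge_pt rho N k.+1)).

(* v is the derivative of g at x in the direction of the outward unit normal
   x / |x| to the circle centred at 0 through x; differentiability along that
   direction is part of the assertion. *)
Definition is_normal_derivative (g : R[i] -> R) (x : R[i]) (v : R) : Prop :=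
  is_derive (0 : R) (1 : R) (fun t : R => g (x + t%:C * (x / `|x|))) v.

End Defs.

(* Main.v *)
Require Import Defs.
From HB Require Import structures.
From mathcomp Require Import all_boot all_order all_algebra.
From mathcomp Require Import all_classical all_reals all_analysis.
From mathcomp Require Import measurable_realfun.
From mathcomp Require Import complex.
From mathcomp Require Import ring lra zify.

Import Order.TTheory GRing.Theory Num.Theory.
Import numFieldNormedType.Exports.

Local Open Scope classical_set_scope.
Local Open Scope ring_scope.

Set Implicit Arguments.
Unset Strict Implicit.
Unset Printing Implicit Defensive.

(** Rotating the contour of Schlaefli's integral for K_0 gives, for X > 0,
      K_0(|X + iY|) = \int_0^oo exp(-X cosh t) cos(Y sinh t) dt,
    which is [besselK0_cartE].  Put X = alpha (rho - s cos phi) and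
    Y = alpha s sin phi.  Then |X + iY| is alpha times the distance from s to
    rho e^{-i phi}, and
      - X cosh t + i Y sinh t = - alpha rho cosh t + alpha s cosh(t + i phi).
    In these coordinates the angle and the radius occur only through
    exp(alpha s w) with w = cosh(t + i phi).  Differentiating in s at s = r
    ([ray_coef_integral], [cart_dkernel_ray]) yields
      c_l = alpha \int_0^oo exp(-alpha rho cosh t) Re(w_l e^{alpha r w_l}) dt,
      w_l = cosh(t + i theta_l) = (e^t omega^l + e^{-t} omega^{-l}) / 2.

    As a function of l, w_l has nonnegative coefficients in the characters of
    Z/N, and so has each of its powers.  Hence the sums over l of
    cos(m theta_l) w_l^e have nonnegative real parts, which are positive when
    m + e = N ([cosh_node_sum_gt0]).  Expanding the exponential transfers this to
    w_l e^{alpha r w_l} ([Re_expsum_ge], [cosh_node_expsum_gt0]).  So the real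
    part of f(omega^m) is the integral of a positive function, while its
    imaginary part cancels because c_{-l} = c_l; this is [f_gt0].

    The conditions on the normal derivative form a circulant linear system.
    The discrete Fourier transform turns it into multiplication by the numbers
    f(omega^m) ([coef_mx_DFT]), so a nonzero vector of coefficients cannot be
    annihilated and the square system has exactly one solution. *)

(** * Hyperbolic functions and exponential decay *)

Section hyperbolic.
Context {R : realType}.
Implicit Types (t x : R).

Definition sinhR t : R := (expR t - expR (- t)) / 2.

Lemma coshR_ge_exp t : expR t / 2 <= coshR t.
Proof. by rewrite /coshR ler_pM2r// lerDl expR_ge0. Qed.

Lemma coshR_gt0 t : 0 < coshR t.
Proof. by rewrite (lt_le_trans _ (coshR_ge_exp t))// divr_gt0 ?expR_gt0. Qed.

Lemma coshR0 : coshR (0 : R) = 1.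
Proof. by rewrite /coshR oppr0 expR0; lra. Qed.

Lemma coshR_ge1 t : 1 <= coshR t.
Proof.
rewrite /coshR expRN; have := expR_gt0 t; set x := expR t => x0.
have : 0 <= (x - 1) ^+ 2 / x by rewrite divr_ge0 ?sqr_ge0 ?ltW.
have -> : (x - 1) ^+ 2 / x = x + x^-1 - 2 by field; rewrite gt_eqF.
by rewrite ler_pdivlMr//; lra.
Qed.

Lemma normr_sinhR_le t : `|sinhR t| <= coshR t.
Proof.
rewrite /sinhR /coshR normrM (gtr0_norm (x := 2^-1))// ler_pM2r//.
by rewrite ler_norml; have := expR_gt0 t; have := expR_gt0 (- t); lra.
Qed.

Lemma sinhR0 : sinhR (0 : R) = 0.
Proof. by rewrite /sinhR oppr0 subrr mul0r. Qed.

Global Instance is_derive_coshR t : is_derive t 1 (@coshR R) (sinhR t).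
Proof.
rewrite /coshR /sinhR; apply: is_derive_eq.
by rewrite /GRing.scale /=; lra.
Qed.

Global Instance is_derive_sinhR t : is_derive t 1 sinhR (coshR t).
Proof.
rewrite /coshR /sinhR; apply: is_derive_eq.
by rewrite /GRing.scale /=; lra.
Qed.

(** The single domination bound behind all integrability claims below.  It
    combines u^2 exp(-kappa u) <= 4 / kappa^2 at u = cosh t with
    cosh t >= e^t / 2; the double exponential decay is traded for e^{-t},
    whose integral is elementary. *)
Lemma bessel_weight_le (kappa t : R) : 0 < kappa ->
  expR (- (kappa * coshR t)) * coshR t <= 8 / kappa ^+ 2 * expR (- t).
Proof.
move=> k0; have u0 := coshR_gt0 t; have := coshR_ge_exp t.
set u := coshR t in u0 *; rewrite !expRN => etu.
have h : (kappa * u / 2) ^+ 2 <= expR (kappa * u).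
  have -> : kappa * u = kappa * u / 2 + kappa * u / 2 by lra.
  rewrite expRD -expr2 -splitr.
  have h0 : 0 <= kappa * u / 2 by rewrite divr_ge0// mulr_ge0// ltW.
  rewrite ler_pXn2r// ?nnegrE ?expR_ge0//.
  by apply: (le_trans _ (expR_ge1Dx _)); lra.
have et0 := expR_gt0 t; have eu0 := expR_gt0 (kappa * u).
have -> : (expR (kappa * u))^-1 * u <= 8 / kappa ^+ 2 * (expR t)^-1 =
    (u * expR t * kappa ^+ 2 <= 8 * expR (kappa * u)).
  rewrite -[LHS]subr_ge0 -[RHS]subr_ge0.
  have -> : 8 / kappa ^+ 2 / expR t - (expR (kappa * u))^-1 * u =
     (8 * expR (kappa * u) - u * expR t * kappa ^+ 2)
      / (kappa ^+ 2 * expR t * expR (kappa * u)).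
    by field; rewrite !gt_eqF.
  by rewrite pmulr_lge0// invr_gt0 !mulr_gt0.
have : u * expR t * kappa ^+ 2 <= u * (2 * u) * kappa ^+ 2.
  rewrite ler_pM2r ?exprn_gt0// ler_pM2l//; lra.
move: h; nra.
Qed.

End hyperbolic.

(** * Integrals over the half-line *)

Section half_line.
Context {R : realType}.
Implicit Types t : R.
Local Notation mu := (@lebesgue_measure R).

Lemma integrable_expRN :
  lebesgue_measure.-integrable `[0, +oo[%classic (EFin \o (fun t : R => expR (- t))).
Proof.
have := @integrable_exponential_pdf R 1 ltr01.
move=> /(integrableS measurableT) => /(_ `[0, +oo[%classic).
move=> /(_ _ (@subsetT _ _)) => H.
have {}H := H ltac:(exact: measurable_itv).
apply: eq_integrable H => //.
move=> t; rewrite inE/= in_itv/= andbT => t0.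
by rewrite exponential_pdfE// mul1r mulN1r.
Qed.

Lemma integrable_of_expdecay (g : R -> R) (C : R) : continuous g ->
  (forall t, 0 <= t -> `|g t| <= C * expR (- t)) ->
  lebesgue_measure.-integrable `[0, +oo[%classic (EFin \o g).
Proof.
move=> cg gC.
have : lebesgue_measure.-integrable `[0, +oo[%classic
    (EFin \o (fun t : R => C * expR (- t))).
  by have := integrableZl _ C integrable_expRN; apply; exact: measurable_itv.
apply: le_integrable => //.
  apply/measurable_EFinP/measurable_funTS; exact: continuous_measurable_fun.
move=> t/=; rewrite in_itv/= andbT => t0.
by rewrite lee_fin (le_trans (gC _ t0))// ler_norm.
Qed.

Lemma cvg_expRN : expR (- t) @[t --> +oo] --> (0 : R).
Proof. exact: cvgr_expR. Qed.

Lemma cvg_of_expdecay (G : R -> R) (C : R) :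
  (forall t, `|G t| <= C * expR (- t)) -> G t @[t --> +oo] --> (0 : R).
Proof.
move=> GC; apply: norm_cvg0.
have h : C * expR (- t) @[t --> +oo] --> (0 : R).
  by rewrite -[X in _ --> X](mulr0 C); apply: cvgM; [exact: cvg_cst|exact: cvg_expRN].
apply: (@squeeze_cvgr _ _ _ _ (cst 0) _ _ _ _ _ h); last exact: cvg_cst.
by apply: nearW => t /=; rewrite normr_ge0 GC.
Qed.

(** Reduction to a nonnegative integrand: g + C e^{-t} is nonnegative by the
    decay bound, and the integral of C e^{-t} is found in the same way. *)
Lemma Rintegral_expdecay_FTC (g G : R -> R) (C : R) :
  continuous g -> (forall t, is_derive t 1 G (g t)) ->
  (forall t, `|g t| <= C * expR (- t)) ->
  G t @[t --> +oo] --> (0 : R) ->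
  \int[mu]_(t in `[0, +oo[) g t = - G 0.
Proof.
move=> cg dG gC G0.
have mB : measurable (`[0, +oo[ : set (measurableTypeR R)).
  exact: measurable_itv.
pose e t := C * expR (- t).
have ce : continuous e.
  by move=> t; rewrite /e; apply/differentiable_continuous/derivable1_diffP.
have de t : is_derive t 1 (fun t => - e t) (e t).
  by rewrite /e; apply: is_derive_eq; rewrite /GRing.scale /=; ring.
have dF t : is_derive t 1 (fun t => G t - e t) (g t + e t).
  have := dG t; have := de t => d1 d2.
  have := is_deriveD d2 d1; exact.
have e0 : e t @[t --> +oo] --> (0 : R).
  by apply: (@cvg_of_expdecay _ `|C|) => t; rewrite normrM (ger0_norm (expR_ge0 _)).
have ie : mu.-integrable `[0, +oo[ (EFin \o e).
  apply: (@integrable_of_expdecay _ `|C|) => // t _.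
  by rewrite normrM (ger0_norm (expR_ge0 _)).
have ig : mu.-integrable `[0, +oo[ (EFin \o g) by exact: (@integrable_of_expdecay _ C).
have C0 : 0 <= C.
  by have := le_trans (normr_ge0 _) (gC 0); rewrite oppr0 expR0 mulr1.
have -> : (\int[mu]_(t in `[0, +oo[) g t) =
    (\int[mu]_(t in `[0, +oo[) (g t + e t)) - (\int[mu]_(t in `[0, +oo[) e t).
  by rewrite RintegralD// addrK.
rewrite (@Rintegral_ge0_continuous_FTC2y _ (fun t => g t + e t)
  (fun t => G t - e t) 0 0).
- rewrite (@Rintegral_ge0_continuous_FTC2y _ e (fun t => - e t) 0 0); first lra.
  + by move=> t _; rewrite mulr_ge0// expR_ge0.
  + exact: continuous_subspaceT.
  + by rewrite -oppr0; exact: cvgN.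
  + by move=> t _; have [] := de t.
  + by apply: cvg_at_right_filter; apply: cvgN; exact: ce.
  + by move=> t _; rewrite derive1E; have [_ ->] := de t.
- by move=> t _; have := gC t; rewrite ler_norml -/(e t) => /andP[]; lra.
- by apply: continuous_subspaceT => t; apply: cvgD; [exact: cg|exact: ce].
- by rewrite -[X in _ --> X](subr0 0); exact: cvgB.
- by move=> t _; have [] := dF t.
- apply: cvg_at_right_filter.
  suff : {for 0, continuous (fun t => G t - e t)} by [].
  by apply/differentiable_continuous/derivable1_diffP; have [] := dF 0.
- by move=> t _; rewrite derive1E; have [_ ->] := dF t.
Qed.

(** If the integral vanished, g would be zero almost everywhere, and the
    half-line would be a null set. *)
Lemma Rintegral_pinfty_gt0 (g : R -> R) :
  mu.-integrable `[0, +oo[ (EFin \o g) -> (forall t : R, 0 <= t -> 0 < g t) ->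
  0 < \int[mu]_(t in `[0, +oo[) g t.
Proof.
move=> ig g0.
have mD : measurable (`[0, +oo[ : set (measurableTypeR R)).
  exact: measurable_itv.
have D0 (t : R) : `[0, +oo[%classic t -> 0 <= t by rewrite /= in_itv/= andbT.
rewrite lt_neqAle Rintegral_ge0 ?andbT; last by move=> t /D0 /g0 /ltW.
apply/eqP => I0.
have : (\int[mu]_(t in `[0%R, +oo[) `|(EFin \o g) t| = 0)%E.
  transitivity (\int[mu]_(t in `[0%R, +oo[) (g t)%:E)%E.
    apply: eq_integral => t; rewrite inE => /D0 /g0 /ltW gt.
    by rewrite /= ger0_norm.
  by rewrite -[LHS]fineK ?integrable_fin_num// -/(Rintegral _ _ _) -I0.
have /integrableP[mg _] := ig.
move=> /(ae_eq_integral_abs mu mD mg) [A [mA A0 sA]].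
have : (mu `[0%R, +oo[ <= mu A)%E.
  apply: le_measure; rewrite ?inE//.
  move=> t Dt; apply: sA => /= /(_ Dt) [] /eqP.
  by rewrite gt_eqF// g0// D0.
by rewrite A0 lebesgue_measure_itv/= lt0y leye_eq.
Qed.

Lemma Rintegral_sum n (F : 'I_n -> R -> R) :
  (forall i, mu.-integrable `[0, +oo[ (EFin \o F i)) ->
  mu.-integrable `[0, +oo[ (EFin \o (fun t => \sum_i F i t)) /\
  \int[mu]_(t in `[0, +oo[) (\sum_i F i t) =
  \sum_i \int[mu]_(t in `[0, +oo[) F i t.
Proof.
have mD : measurable (`[0, +oo[ : set (measurableTypeR R)).
  exact: measurable_itv.
elim: n F => [F iF|n IH F iF].
  have -> : (fun t : R => \sum_(i < 0) F i t) = cst 0.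
    by apply: funext => t; rewrite big_ord0.
  split; first exact: integrable0.
  by rewrite big_ord0 /Rintegral integral0.
have -> : (fun t => \sum_i F i t) =
    (fun t => F ord0 t + \sum_i F (lift ord0 i) t).
  by apply: funext => t; rewrite big_ord_recl.
have [i1 e1] := IH _ (fun i => iF (lift ord0 i)).
split; first exact: integrableD (iF ord0) i1.
by rewrite RintegralD// e1 big_ord_recl.
Qed.

End half_line.

(** * The function K_0 in Cartesian coordinates *)

Section cartesian.
Context {R : realType}.
Implicit Types (t x X Y : R).
Local Notation mu := (@lebesgue_measure R).

Definition cart_kernel X Y t : R := expR (- (X * coshR t)) * cos (Y * sinhR t).

(** The rate of change of [cart_kernel] when X and Y move with velocities P and Q. *)
Definition cart_dkernel X Y P Q t : R :=
  expR (- (X * coshR t)) *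
  (- P * coshR t * cos (Y * sinhR t) - Q * sinhR t * sin (Y * sinhR t)).

Definition besselK0_cart X Y : R := \int[mu]_(t in `[0, +oo[) cart_kernel X Y t.

Lemma continuous_cart_kernel X Y : continuous (cart_kernel X Y).
Proof.
by move=> t; rewrite /cart_kernel; apply/differentiable_continuous/derivable1_diffP.
Qed.

Lemma continuous_cart_dkernel X Y P Q : continuous (cart_dkernel X Y P Q).
Proof.
by move=> t; rewrite /cart_dkernel; apply/differentiable_continuous/derivable1_diffP.
Qed.

Lemma normr_cart_kernel_le kappa X Y t : 0 < kappa -> kappa <= X ->
  `|cart_kernel X Y t| <= 8 / kappa ^+ 2 * expR (- t).
Proof.
move=> k0 kX; rewrite (le_trans _ (bessel_weight_le t k0))//.
rewrite normrM (ger0_norm (expR_ge0 _)) ler_pM ?expR_ge0//.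
  by rewrite ler_expR lerN2 ler_pM2r// coshR_gt0.
by rewrite (le_trans (cos_max _))// coshR_ge1.
Qed.

Lemma normr_cart_dkernel_le kappa M X Y P Q t : 0 < kappa -> kappa <= X ->
  `|P| <= M -> `|Q| <= M ->
  `|cart_dkernel X Y P Q t| <= 2 * M * (8 / kappa ^+ 2) * expR (- t).
Proof.
move=> k0 kX PM QM.
have M0 : 0 <= M by rewrite (le_trans _ PM).
rewrite -mulrA (le_trans _ (ler_wpM2l _ (bessel_weight_le t k0)))//; last first.
  by rewrite mulr_ge0.
rewrite mulrCA normrM (ger0_norm (expR_ge0 _)) ler_pM ?expR_ge0//.
  by rewrite ler_expR lerN2 ler_pM2r// coshR_gt0.
have -> : 2 * M * coshR t = M * coshR t * 1 + M * coshR t * 1 by ring.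
have := normr_sinhR_le t; have := ltW (coshR_gt0 t).
move: (coshR t) (sinhR t) => c s c0 sc.
rewrite (le_trans (ler_normB _ _))// !normrM normrN (ger0_norm c0).
by rewrite lerD// ler_pM ?mulr_ge0 ?cos_max ?sin_max// ler_pM.
Qed.

Lemma integrable_cart_kernel X Y : 0 < X ->
  mu.-integrable `[0, +oo[%classic (EFin \o cart_kernel X Y).
Proof.
move=> X0; apply: (@integrable_of_expdecay _ _ (8 / X ^+ 2)).
  exact: continuous_cart_kernel.
by move=> t _; exact: normr_cart_kernel_le.
Qed.

Lemma integrable_cart_dkernel X Y P Q : 0 < X ->
  mu.-integrable `[0, +oo[%classic (EFin \o cart_dkernel X Y P Q).
Proof.
move=> X0; pose M := Num.max `|P| `|Q|.
apply: (@integrable_of_expdecay _ _ (2 * M * (8 / X ^+ 2))).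
  exact: continuous_cart_dkernel.
by move=> t _; apply: normr_cart_dkernel_le => //; rewrite le_max lexx ?orbT.
Qed.

(** Differentiation under the integral sign along an arbitrary moving point
    (X(s), Y(s)).  It is used along circles (for the rotation invariance),
    along the real axis (for K_0' = - K_1), and along the segments described
    by a collocation point that moves radially. *)
Lemma is_derive_besselK0_cart (fX fY fP fQ : R -> R) (u v kappa M a : R) :
  u < a < v -> 0 < kappa ->
  (forall s, u < s < v -> is_derive s 1 fX (fP s)) ->
  (forall s, u < s < v -> is_derive s 1 fY (fQ s)) ->
  (forall s, u < s < v -> kappa <= fX s) ->
  (forall s, u < s < v -> `|fP s| <= M) ->
  (forall s, u < s < v -> `|fQ s| <= M) ->
  is_derive a 1 (fun s => besselK0_cart (fX s) (fY s))
    (\int[mu]_(t in `[0, +oo[) cart_dkernel (fX a) (fY a) (fP a) (fQ a) t).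
Proof.
move=> uav k0 dX dY kX PM QM.
have M0 : 0 <= M by rewrite (le_trans _ (PM a uav)).
pose F s t := cart_kernel (fX s) (fY s) t.
have dF s t : u < s < v ->
    is_derive s 1 (F ^~ t) (cart_dkernel (fX s) (fY s) (fP s) (fQ s) t).
  move=> sI; have := dX s sI; have := dY s sI => dYs dXs.
  rewrite /F /cart_kernel /cart_dkernel; apply: is_derive_eq.
  by rewrite /GRing.scale /=; ring.
have Ia : `]u, v[%classic a by rewrite /= in_itv.
have mB : measurable (`[0, +oo[%classic : set (measurableTypeR R)).
  exact: measurable_itv.
have pF s t : u < s < v -> partial1of2 F s t =
    cart_dkernel (fX s) (fY s) (fP s) (fQ s) t.
  by move=> sI; rewrite partial1of2E; have [_ ->] := dF s t sI.
have := @cvg_differentiation_under_integral R _ _ mu F `[0, +oo[%classic mB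
  a u v Ia _ _ (fun t => 2 * M * (8 / kappa ^+ 2) * expR (- t)) _ _ _.
have -> : (\int[mu]_(y in `[0, +oo[) partial1of2 F a y)%R =
   (\int[mu]_(t in `[0, +oo[) cart_dkernel (fX a) (fY a) (fP a) (fQ a) t)%R.
  by apply: eq_Rintegral => t _; rewrite pF.
move=> H.
have {}H : h^-1 *: (besselK0_cart (fX (h + a)) (fY (h + a)) - besselK0_cart (fX a) (fY a)) @[h --> 0^'] -->
    (\int[mu]_(t in `[0, +oo[) cart_dkernel (fX a) (fY a) (fP a) (fQ a) t)%R.
  apply: H.
  - move=> s /=; rewrite in_itv/= => sI; apply: integrable_cart_kernel.
    exact: lt_le_trans (kX _ sI).
  - by move=> s t /=; rewrite in_itv/= => sI _; have [] := dF s t sI.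
  - by move=> t; rewrite !mulr_ge0 ?expR_ge0// invr_ge0 sqr_ge0.
  - by have := integrableZl _ (2 * M * (8 / kappa ^+ 2)) integrable_expRN; apply.
  - move=> s t /=; rewrite !in_itv/= => sI _; rewrite pF//.
    by apply: normr_cart_dkernel_le; rewrite ?kX ?PM ?QM.
split.
  apply/cvg_ex; exists (\int[mu]_(t in `[0, +oo[) cart_dkernel (fX a) (fY a) (fP a) (fQ a) t)%R.
  by under eq_fun do rewrite scaler1.
apply/cvg_lim => //.
by under eq_fun do rewrite scaler1.
Qed.

(** Under a rotation the point moves with velocity (- Y, X), and then the
    integrand is the t-derivative of exp(-X cosh t) sin(Y sinh t) by the
    Cauchy-Riemann equations.  That primitive vanishes at both ends. *)
Lemma Rintegral_cart_dkernel_rot X Y : 0 < X ->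
  \int[mu]_(t in `[0, +oo[) cart_dkernel X Y (- Y) X t = 0.
Proof.
move=> X0.
pose G t := expR (- (X * coshR t)) * sin (Y * sinhR t).
pose M := Num.max `|- Y| `|X|.
have dG t : is_derive t 1 G (cart_dkernel X Y (- Y) X t).
  by rewrite /G /cart_dkernel; apply: is_derive_eq; rewrite /GRing.scale /=; ring.
transitivity (- G 0); last by rewrite /G sinhR0 mulr0 sin0 mulr0 oppr0.
apply: (@Rintegral_expdecay_FTC _ _ G (2 * M * (8 / X ^+ 2)) _ dG).
- exact: continuous_cart_dkernel.
- by move=> t; apply: normr_cart_dkernel_le => //; rewrite le_max lexx ?orbT.
- apply: (@cvg_of_expdecay _ _ (8 / X ^+ 2)) => t.
  rewrite (le_trans _ (bessel_weight_le t X0))//.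
  rewrite normrM (ger0_norm (expR_ge0 _)) ler_pM ?expR_ge0//.
  by rewrite (le_trans (sin_max _))// coshR_ge1.
Qed.

(** Contour rotation: the integral is constant on the part of each circle
    centred at 0 that lies in the right half-plane. *)
Lemma besselK0_cart_rot (z p : R) : 0 < z -> - (pi / 2) < p < pi / 2 ->
  besselK0_cart (z * cos p) (z * sin p) = besselK0_cart z 0.
Proof.
move=> z0 pI.
pose f s := besselK0_cart (z * cos s) (z * sin s).
have df a : - (pi / 2) < a < pi / 2 -> is_derive a 1 f 0.
  (* q lies strictly between |a| and pi / 2, so that cos is bounded below by
     cos q > 0 on the neighbourhood ]- q, q[ of a *)
  move=> aI; pose q := (`|a| + pi / 2) / 2.
  have aq : `|a| < pi / 2 by rewrite ltr_norml.
  have [a0 p2] : 0 <= `|a| /\ 2 <= pi :> R by rewrite normr_ge0 pi_ge2.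
  have cq : 0 < cos q by apply: cos_gt0_pihalf; rewrite /q; lra.
  have ca : 0 < cos a by exact: cos_gt0_pihalf.
  rewrite -(@Rintegral_cart_dkernel_rot (z * cos a) (z * sin a)) ?mulr_gt0//.
  apply: (@is_derive_besselK0_cart (fun s => z * cos s) (fun s => z * sin s)
     (fun s => - (z * sin s)) (fun s => z * cos s) (- q) q (z * cos q) z).
  - by rewrite -ltr_norml /q; lra.
  - by rewrite mulr_gt0.
  - by move=> s _; apply: is_derive_eq; rewrite /GRing.scale /=; ring.
  - move=> s; rewrite -ltr_norml => sq; rewrite ler_pM2l//.
    have -> : cos s = cos `|s| by rewrite cos_norm.
    have := normr_ge0 s => s0.
    have [sI qI] : `|s| \in `[0, pi] /\ q \in `[0, pi].
      by rewrite !in_itv/=; split; apply/andP; split; rewrite /q in sq *; lra.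
    by rewrite leNgt ltr_cos// -leNgt ltW.
  - by move=> s _; rewrite normrN normrM gtr0_norm// ler_piMr ?sin_max// ltW.
  - by move=> s _; rewrite normrM gtr0_norm// ler_piMr ?cos_max// ltW.
have cst_seg (a b : R) : - (pi / 2) < a -> a <= b -> b < pi / 2 -> f a = f b.
  move=> a1 ab b1.
  have abI s : a <= s <= b -> - (pi / 2) < s < pi / 2 by move=> /andP[? ?]; apply/andP; split; lra.
  have cf : {within `[a, b], continuous f}.
    apply: derivable_within_continuous => s; rewrite in_itv/= => /abI sI.
    by have [] := df s sI.
  have dI s : s \in `]a, b[ -> is_derive s 1 f 0.
    rewrite in_itv/= => /andP[sa sb]; apply: df; apply: abI.
    by apply/andP; split; exact: ltW.
  have [s _] := MVT_segment ab dI cf.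
  by rewrite mul0r => /eqP; rewrite subr_eq0 eq_sym => /eqP.
have := @pi_gt0 R => pi0.
have <- : f 0 = besselK0_cart z 0 by rewrite /f cos0 sin0 mulr1 mulr0.
have [p0|p0] := leP 0 p; first by symmetry; apply: cst_seg; lra.
by apply: cst_seg; lra.
Qed.

Lemma besselK0_cart0 x : besselK 0 x = besselK0_cart x 0.
Proof.
rewrite /besselK /besselK0_cart; apply: eq_Rintegral => t _.
by rewrite /cart_kernel !mul0r cos0 coshR0.
Qed.

Lemma is_derive_besselK0 x : 0 < x -> is_derive x 1 (besselK 0) (- besselK 1 x).
Proof.
move=> x0.
have -> : - besselK 1 x = \int[mu]_(t in `[0, +oo[) cart_dkernel x 0 1 0 t.
  rewrite -mulN1r /besselK -RintegralZl.
  - by apply: eq_Rintegral => t _; rewrite /cart_dkernel !mul0r mul1r cos0; ring.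
  - exact: measurable_itv.
  - have -> : (fun t => expR (- (x * coshR t)) * coshR (1 * t)) =
        cart_dkernel x 0 (- 1) 0.
      by apply/funext => t; rewrite /cart_dkernel !mul0r mul1r cos0; ring.
    exact: integrable_cart_dkernel.
have -> : besselK (0 : R) = (fun s : R => besselK0_cart s 0).
  by apply: funext => s; exact: besselK0_cart0.
apply: (@is_derive_besselK0_cart id (cst 0) (cst 1) (cst 0) (x / 2) (x * 2) (x / 2) 1).
- by apply/andP; split; lra.
- by rewrite divr_gt0.
- by move=> s /andP[/ltW].
- by move=> s _; rewrite normr1.
- by move=> s _; rewrite normr0.
Qed.

Lemma besselK0_cartE X Y : 0 < X ->
  besselK0_cart X Y = besselK 0 (Num.sqrt (X ^+ 2 + Y ^+ 2)).
Proof.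
move=> X0; rewrite besselK0_cart0; set z := Num.sqrt _.
have z2 : z ^+ 2 = X ^+ 2 + Y ^+ 2 by rewrite sqr_sqrtr// addr_ge0 ?sqr_ge0.
have z0 : 0 < z by rewrite sqrtr_gt0 ltr_wpDr ?sqr_ge0 ?exprn_gt0.
have Yz : `|Y / z| < 1.
  rewrite normrM normfV (gtr0_norm z0) ltr_pdivrMr// mul1r.
  rewrite -(ltr_pXn2r (n := 2))// ?nnegrE ?(ltW z0)// real_normK ?num_real// z2.
  by rewrite ltrDr exprn_gt0.
have /andP[Y1 Y2] : -1 < Y / z < 1 by rewrite -ltr_norml.
have Yz1 : -1 <= Y / z <= 1 by rewrite !ltW.
(* asin (Y / z) is the polar angle of X + iY, because X > 0 *)
rewrite -(@besselK0_cart_rot z (asin (Y / z)))//; last first.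
  by rewrite asin_ltpi2 ?asin_gtNpi2// ?Y1 ?Y2 ?ltW.
rewrite cos_asin// asinK ?in_itv//=.
have -> : 1 - (Y / z) ^+ 2 = (X / z) ^+ 2.
  by rewrite !expr_div_n z2; field; rewrite -z2 expf_neq0// gt_eqF.
rewrite sqrtr_sqr gtr0_norm ?divr_gt0//.
by rewrite !(mulrC z) !divfK// gt_eqF.
Qed.

End cartesian.

(** * The coefficients of the system as integrals *)

Section ray.
Local Open Scope complex_scope.
Context {R : realType}.
Variables (alpha rho : R).
Hypotheses (alpha_gt0 : 0 < alpha).
Implicit Types (s r phi : R).
Local Notation mu := (@lebesgue_measure R).

Definition ray_dist phi s : R := normc (s%:C - rho%:C * expi (- phi)).

(** The coefficient c_l at an arbitrary angle phi instead of theta_l. *)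
Definition ray_coef phi s : R :=
  - alpha * besselK 1 (alpha * ray_dist phi s)
    * ((s - rho * cos phi) / ray_dist phi s).

Lemma ray_distE phi s :
  ray_dist phi s = Num.sqrt ((s - rho * cos phi) ^+ 2 + (rho * sin phi) ^+ 2).
Proof.
rewrite /ray_dist /expi /= cosN sinN; congr Num.sqrt.
by rewrite /=; ring.
Qed.

(** By the law of cosines the squared distance is at least (rho - s)^2. *)
Lemma ray_sqdist_gt0 phi s : 0 < s < rho ->
  0 < (s - rho * cos phi) ^+ 2 + (rho * sin phi) ^+ 2.
Proof.
move=> /andP[s0 sr].
have -> : (s - rho * cos phi) ^+ 2 + (rho * sin phi) ^+ 2 =
    (rho - s) ^+ 2 + 2 * (s * rho) * (1 - cos phi).
  have -> : (rho * sin phi) ^+ 2 = rho ^+ 2 * (1 - cos phi ^+ 2).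
    by rewrite exprMn sin2cos2.
  ring.
have := cos_le1 phi; have : 0 < s * rho by rewrite mulr_gt0// (lt_trans s0).
have : 0 < (rho - s) ^+ 2 by rewrite exprn_gt0// subr_gt0.
nra.
Qed.

Lemma is_derive_ray phi r : 0 < r < rho ->
  is_derive r 1 (fun s => besselK 0 (alpha * ray_dist phi s)) (ray_coef phi r).
Proof.
move=> rI; have D0 := ray_sqdist_gt0 phi rI.
pose q s : R := (s - rho * cos phi) ^+ 2 + (rho * sin phi) ^+ 2.
have d0 : 0 < Num.sqrt (q r) by rewrite sqrtr_gt0.
have dq : is_derive r 1 q (2 * (r - rho * cos phi)).
  by rewrite /q; apply: is_derive_eq; rewrite /GRing.scale /=; ring.
have dS : is_derive (q r) 1 Num.sqrt (2 * Num.sqrt (q r))^-1 := is_derive1_sqrt D0.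
have dsq := is_derive1_comp dS dq.
have dx : is_derive r 1 (fun s => alpha * (Num.sqrt \o q) s)
     (alpha * ((2 * Num.sqrt (q r))^-1 * (2 * (r - rho * cos phi)))).
  by apply: is_derive_eq; rewrite /GRing.scale /=; ring.
have x0 : 0 < alpha * Num.sqrt (q r) by rewrite mulr_gt0.
have := @is_derive1_comp _ (besselK 0) (fun s => alpha * (Num.sqrt \o q) s) r
  _ _ (is_derive_besselK0 x0) dx.
have -> : besselK (0 : R) \o (fun s => alpha * (Num.sqrt \o q) s) =
    (fun s => besselK 0 (alpha * ray_dist phi s)).
  by apply: funext => s /=; rewrite ray_distE.
have -> : - besselK 1 (alpha * Num.sqrt (q r)) *
   (alpha * ((2 * Num.sqrt (q r))^-1 * (2 * (r - rho * cos phi)))) = ray_coef phi r.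
  by rewrite /ray_coef ray_distE -/(q r); field; rewrite gt_eqF.
by [].
Qed.

(** Both sides are the derivative at r of K_0(alpha d(s)), where d(s) is the
    distance from s to rho e^{-i phi}: once by the chain rule and
    K_0' = - K_1, once under the integral sign in Cartesian coordinates. *)
Lemma ray_coef_integral phi r : 0 < r < rho ->
  ray_coef phi r = \int[mu]_(t in `[0, +oo[)
    cart_dkernel (alpha * (rho - r * cos phi)) (alpha * (r * sin phi))
             (- (alpha * cos phi)) (alpha * sin phi) t.
Proof.
(* v lies strictly between r and rho, so that rho - s cos phi is bounded below
   by rho - v > 0 for s in ]0, v[ *)
move=> rI; have /andP[r0 rr] := rI; pose v := (r + rho) / 2.
have d1 := is_derive_ray phi rI.
pose X s := alpha * (rho - s * cos phi).
pose Y s := alpha * (s * sin phi).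
have vI s : 0 < s < v -> v < rho /\ s * cos phi <= v.
  rewrite /v => /andP[s0 sv]; split; first lra.
  have := cos_le1 phi; nra.
have X0 s : 0 < s < v -> alpha * (rho - v) <= X s.
  by move=> /vI[? ?]; rewrite /X ler_pM2l//; lra.
have d2 : is_derive r 1 (fun s => besselK0_cart (X s) (Y s)) (\int[mu]_(t in `[0, +oo[)
    cart_dkernel (X r) (Y r) (- (alpha * cos phi)) (alpha * sin phi) t).
  apply: (@is_derive_besselK0_cart R X Y (cst (- (alpha * cos phi)))
     (cst (alpha * sin phi)) 0 v (alpha * (rho - v)) alpha).
  - by rewrite /v; apply/andP; split; lra.
  - by rewrite mulr_gt0// /v; lra.
  - by move=> s sI; rewrite /X; apply: is_derive_eq; rewrite /GRing.scale /=; ring.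
  - by move=> s sI; rewrite /Y; apply: is_derive_eq; rewrite /GRing.scale /=; ring.
  - exact: X0.
  - by move=> s _; rewrite normrN normrM gtr0_norm// ler_piMr ?cos_max// ltW.
  - by move=> s _; rewrite normrM gtr0_norm// ler_piMr ?sin_max// ltW.
have near_eq : \near r, besselK0_cart (X r) (Y r) = besselK 0 (alpha * ray_dist phi r).
  have rv : r \in `]0, v[ by rewrite in_itv/= r0/= /v; lra.
  have := near_in_itvoo rv; apply: filterS => s; rewrite in_itv/= => sI.
  have Xs : 0 < X s.
    by apply: lt_le_trans (X0 _ sI); rewrite mulr_gt0// /v; lra.
  rewrite besselK0_cartE// ray_distE; congr besselK.
  rewrite -[X in X * Num.sqrt _]gtr0_norm// -sqrtr_sqr -sqrtrM ?sqr_ge0//.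
  congr Num.sqrt; rewrite /X /Y !exprMn sin2cos2; ring.
have := near_eq_is_derive near_eq d2 => d3.
by have [_ <-] := d1; have [_ ->] := d3.
Qed.

End ray.

(** * Exponential sums with nonnegative power sums *)

Section expsum.
Local Open Scope complex_scope.
Context {R : realType}.
Local Notation Re := (@complex.Re R).
Local Notation Im := (@complex.Im R).

Lemma ge0_derive_le (h dh : R -> R) (a b : R) : a <= b ->
  (forall s : R, is_derive s 1 h (dh s)) ->
  (forall s, a <= s <= b -> 0 <= dh s) -> h a <= h b.
Proof.
move=> ab dH h0.
have ch : {within `[a, b], continuous h}.
  by apply: derivable_within_continuous => s _; have [] := dH s.
have [s sI] := MVT_segment ab (fun s _ => dH s) ch.
rewrite -subr_ge0 => ->; rewrite mulr_ge0 ?subr_ge0//.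
by apply: h0; move: sI; rewrite in_itv.
Qed.

Lemma is_derive_pow_fact n (x : R) :
  is_derive x 1 (fun s : R => s ^+ n.+1 / n.+1`!%:R) (x ^+ n / n`!%:R).
Proof.
have dX : is_derive x 1 (fun s : R => s ^+ n.+1) (n.+1%:R * x ^+ n).
  have -> : (fun s : R => s ^+ n.+1) = id ^+ n.+1 by rewrite exprfctE.
  by apply: is_derive_eq; rewrite /GRing.scale /= mulr1.
apply: is_derive_eq; rewrite /GRing.scale /= factS natrM.
have f0 : n`!%:R != 0 :> R by rewrite pnatr_eq0 -lt0n fact_gt0.
have n0 : n.+1%:R != 0 :> R by rewrite pnatr_eq0.
by field; rewrite f0 addrC natr1 n0.
Qed.

Section absolutely_monotone.
Variables (G : nat -> R -> R) (a C M : R).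
Hypothesis dG : forall k (s : R), is_derive s 1 (G k) (G k.+1 s).
Hypothesis G_le : forall k (s : R), 0 <= s <= a -> `|G k s| <= C * M ^+ k.
Hypothesis G0_ge0 : forall k, 0 <= G k 0.

(** Taylor's formula at 0 in which the nonnegative coefficients G (k + i) 0 are
    dropped and only the remainder of order n is kept; by induction on n, the
    bound for G (k + 1) is integrated. *)
Lemma abs_monotone_taylor n k (s : R) : 0 <= s <= a ->
  - (C * M ^+ (k + n) * (s ^+ n / n`!%:R)) <= G k s.
Proof.
elim: n k s => [|n IH] k s sI.
  rewrite expr0 fact0 addn0 divr1 mulr1.
  by have := G_le k sI; rewrite ler_norml => /andP[].
have /andP[s0 sa] := sI.
pose c := C * M ^+ (k + n.+1).
pose h (s : R) := G k s + c * (s ^+ n.+1 / n.+1`!%:R).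
pose dh (s : R) := G k.+1 s + c * (s ^+ n / n`!%:R).
have dH (x : R) : is_derive x 1 h (dh x).
  have := dG k x; have := is_derive_pow_fact n x => dpx dGx.
  by rewrite /h /dh; apply: is_derive_eq; rewrite /GRing.scale /=; ring.
have : h 0 <= h s.
  apply: (ge0_derive_le s0 dH) => x /andP[x0 xs].
  rewrite /dh /c -addSnnS -lerBlDr sub0r; apply: IH.
  by rewrite x0 (le_trans xs).
by rewrite /h expr0n/= mul0r mulr0 addr0; have := G0_ge0 k; rewrite /c; lra.
Qed.

(** The remainder C M^k (M s)^n / n! tends to 0 with n. *)
Lemma abs_monotone_ge0 k (s : R) : 0 <= s <= a -> 0 <= G k s.
Proof.
move=> sI; have /andP[s0 sa] := sI.
have h n : - (C * M ^+ k * exp_coeff (M * s) n) <= G k s.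
  apply: le_trans (abs_monotone_taylor n k sI).
  by rewrite /exp_coeff /= exprD exprMn !mulrA.
have cv : - (C * M ^+ k * exp_coeff (M * s) n) @[n --> \oo] --> - (C * M ^+ k * 0).
  by apply: cvgN; apply: cvgM; [exact: cvg_cst|exact: cvg_exp_coeff].
rewrite mulr0 oppr0 in cv.
rewrite -(cvg_lim (@Rhausdorff R) cv); apply: limr_le; first by apply/cvg_ex; exists 0.
by apply: nearW => n; exact: h.
Qed.

(** A term of the Taylor expansion bounds the function from below, since all
    derivatives stay nonnegative. *)
Lemma abs_monotone_ge_coef j k (s : R) : 0 <= s <= a ->
  G (k + j) 0 * (s ^+ j / j`!%:R) <= G k s.
Proof.
elim: j k s => [|j IH] k s sI; have /andP[s0 sa] := sI.
  rewrite expr0 fact0 addn0 divr1 mulr1.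
  apply: (ge0_derive_le s0 (dG k)) => x /andP[x0 xs].
  by apply: abs_monotone_ge0; rewrite x0 (le_trans xs).
pose c := G (k + j.+1) 0.
pose h (s : R) := G k s - c * (s ^+ j.+1 / j.+1`!%:R).
pose dh (s : R) := G k.+1 s - c * (s ^+ j / j`!%:R).
have dH (x : R) : is_derive x 1 h (dh x).
  have := dG k x; have := is_derive_pow_fact j x => dpx dGx.
  by rewrite /h /dh; apply: is_derive_eq; rewrite /GRing.scale /=; ring.
have : h 0 <= h s.
  apply: (ge0_derive_le s0 dH) => x /andP[x0 xs].
  rewrite /dh /c -addSnnS subr_ge0; apply: IH.
  by rewrite x0 (le_trans xs).
by rewrite /h expr0n/= mul0r mulr0 subr0; have := G0_ge0 k; rewrite /c; lra.
Qed.

End absolutely_monotone.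

Definition cexp (z : R[i]) : R[i] := (expR (Re z))%:C * expi (Im z).

Lemma cexp0 : cexp 0 = 1.
Proof. by rewrite /cexp /expi expR0 mul1r cos0 sin0. Qed.

Lemma is_derive_Re_cexp (v z : R[i]) (s : R) :
  is_derive s 1 (fun s : R => Re (v * cexp (s%:C * z)))
    (Re (v * z * cexp (s%:C * z))).
Proof.
case: v z => [a b] [x y].
have E (c d q : R) : Re ((c +i* d) * cexp (q%:C * (x +i* y))) =
    expR (q * x) * (c * cos (q * y) - d * sin (q * y)).
  by rewrite /cexp /expi /= !mul0r !subr0 !addr0; ring.
have -> : (fun s : R => Re ((a +i* b) * cexp (s%:C * (x +i* y)))) =
   (fun s : R => expR (s * x) * (a * cos (s * y) - b * sin (s * y))).
  by apply: funext => u; rewrite E.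
have -> : (a +i* b) * (x +i* y) = (a * x - b * y) +i* (a * y + b * x) by [].
by rewrite E; apply: is_derive_eq; rewrite /GRing.scale /=; ring.
Qed.

Lemma normr_Re_le (z : R[i]) : `|Re z| <= normc z.
Proof. by have := normc_ge_Re z; rewrite lecR. Qed.

Lemma normc_cexp (z : R[i]) : normc (cexp z) = expR (Re z).
Proof.
rewrite /cexp ComplexField.Normc.normcM /expi /= cos2Dsin2 sqrtr1 mulr1.
by rewrite expr0n /= addr0 sqrtr_sqr ger0_norm ?expR_ge0.
Qed.

Lemma normcX (z : R[i]) k : normc (z ^+ k) = normc z ^+ k.
Proof.
elim: k => [|k IH]; first by rewrite !expr0 ComplexField.Normc.normc1.
by rewrite !exprS ComplexField.Normc.normcM IH.
Qed.

Lemma normc_ge0 (z : R[i]) : 0 <= normc z.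
Proof. by case: z => x y; exact: sqrtr_ge0. Qed.

(** The successive derivatives in s of Re (\sum_l u_l e^{s w_l}) are
    Re (\sum_l u_l w_l^k e^{s w_l}).  They are nonnegative at s = 0 and grow
    at most geometrically in k, so the exponential sum is at least each term
    of its Taylor expansion. *)
Lemma Re_expsum_ge n (u w : 'I_n -> R[i]) (a : R) j : 0 <= a ->
  (forall k, 0 <= Re (\sum_l u l * w l ^+ k)) ->
  Re (\sum_l u l * w l ^+ j) * (a ^+ j / j`!%:R) <=
  Re (\sum_l u l * cexp (a%:C * w l)).
Proof.
move=> a0 pos.
pose G k s := \sum_l Re (u l * w l ^+ k * cexp (s%:C * w l)).
have ReS (F : 'I_n -> R[i]) : Re (\sum_l F l) = \sum_l Re (F l).
  exact: (raddf_sum (@complex.Re R : Rcomplex R -> R)).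
have G0 k : G k 0 = Re (\sum_l u l * w l ^+ k).
  by rewrite ReS; apply: eq_bigr => l _; rewrite mul0r cexp0 mulr1.
have Ga : Re (\sum_l u l * cexp (a%:C * w l)) = G 0%N a.
  by rewrite ReS; apply: eq_bigr => l _; rewrite expr0 mulr1.
rewrite Ga -G0.
(* a common bound for all |w_l| *)
pose M := \sum_l normc (w l).
have M_ge0 : 0 <= M by apply: sumr_ge0 => l _; exact: normc_ge0.
have wM l : normc (w l) <= M.
  by rewrite /M (bigD1 l)//= lerDl sumr_ge0// => i _; exact: normc_ge0.
rewrite -[X in G X 0]add0n.
apply: (@abs_monotone_ge_coef G a (\sum_l normc (u l) * expR (a * M)) M).
- move=> k s.
  have -> : G k = \sum_l (fun s => Re (u l * w l ^+ k * cexp (s%:C * w l))).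
    by apply: funext => x; rewrite fct_sumE.
  have -> : G k.+1 s = \sum_l Re (u l * w l ^+ k * w l * cexp (s%:C * w l)).
    by apply: eq_bigr => l _; rewrite exprSr mulrA.
  by apply: is_derive_sum => l; exact: is_derive_Re_cexp.
- move=> k s /andP[s0 sa]; rewrite mulr_suml.
  apply: le_trans (ler_norm_sum _ _ _) _; apply: ler_sum => l _.
  rewrite (le_trans (normr_Re_le _))// ComplexField.Normc.normcM normc_cexp
    ComplexField.Normc.normcM normcX.
  have wk : 0 <= normc (w l) ^+ k by rewrite exprn_ge0 ?normc_ge0.
  have wMk : normc (w l) ^+ k <= M ^+ k by rewrite lerXn2r ?nnegrE ?normc_ge0.
  rewrite mulrAC ler_pM ?mulr_ge0 ?normc_ge0 ?expR_ge0//.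
  rewrite ler_wpM2l ?normc_ge0// ler_expR.
  have -> : Re (s%:C * w l) = s * Re (w l) by case: (w l) => x y /=; rewrite mul0r subr0.
  have h : Re (w l) <= M := le_trans (ler_norm _) (le_trans (normr_Re_le _) (wM l)).
  by rewrite (le_trans (ler_wpM2l s0 h))// ler_wpM2r.
- by move=> k; rewrite G0.
- by rewrite a0 lexx.
Qed.

End expsum.

(** * Power sums over the roots of unity *)

Section roots_of_unity.
Local Open Scope complex_scope.
Context {R : realType}.
Local Notation Re := (@complex.Re R).

Lemma sum_unity_root_ge0 N (z : R[i]) : z ^+ N = 1 -> 0 <= \sum_(l < N) z ^+ l.
Proof.
move=> zN; have [->|z1] := eqVneq z 1.
  by rewrite sumr_ge0// => i _; rewrite expr1n.
have : (z - 1) * \sum_(l < N) z ^+ l = 0 by rewrite -subrX1 zN subrr.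
by move=> /eqP; rewrite mulf_eq0 subr_eq0 (negPf z1)/= => /eqP ->.
Qed.

Section power_sums.
Variables (N : nat) (z p q : R[i]).
Hypotheses (zN : z ^+ N = 1) (p0 : 0 <= p) (q0 : 0 <= q).

(* N.-1 plays the part of -1, because z ^+ N = 1 *)
Let w l := p * z ^+ l + q * z ^+ (N.-1 * l).

Lemma unity_power_sumS e m :
  \sum_(l < N) z ^+ (m * l) * w l ^+ e.+1 =
  p * \sum_(l < N) z ^+ (m.+1 * l) * w l ^+ e +
  q * \sum_(l < N) z ^+ ((m + N.-1) * l) * w l ^+ e.
Proof.
rewrite !mulr_sumr -big_split /=; apply: eq_bigr => l _.
rewrite exprS mulSn mulnDl !exprD /w; ring.
Qed.

(** Multiplication by w shifts the frequency by one in either direction, with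
    nonnegative weights; at exponent 0 the sum is N or 0. *)
Lemma unity_power_sum_ge0 e m : 0 <= \sum_(l < N) z ^+ (m * l) * w l ^+ e.
Proof.
elim: e m => [|e IH] m.
  under eq_bigr do rewrite expr0 mulr1 exprM.
  by apply: sum_unity_root_ge0; rewrite -exprM mulnC exprM zN expr1n.
by rewrite unity_power_sumS addr_ge0// mulr_ge0.
Qed.

(** Raising the frequency e = N - m times leads from m to N, where the sum of
    the powers of z is N; all other contributions are nonnegative. *)
Lemma unity_power_sum_gt0 e m : (0 < N)%N -> 0 < p -> (m + e = N)%N ->
  0 < \sum_(l < N) z ^+ (m * l) * w l ^+ e.
Proof.
move=> N0 pp; elim: e m => [|e IH] m meN.
  rewrite addn0 in meN; subst m.
  under eq_bigr do rewrite expr0 mulr1 exprM zN expr1n.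
  by rewrite sumr_const card_ord ltr0n.
rewrite unity_power_sumS ltr_pwDl//.
  by rewrite mulr_gt0// IH// addSnnS.
by rewrite mulr_ge0// unity_power_sum_ge0.
Qed.

End power_sums.

Lemma expiD (x y : R) : expi (x + y) = expi x * expi y.
Proof.
rewrite /expi cosD sinD; apply/eqP.
by rewrite eq_complex /= eqxx/= addrC.
Qed.

Lemma expi0 : expi (0 : R) = 1.
Proof. by rewrite /expi cos0 sin0. Qed.

Lemma expiX (x : R) k : expi x ^+ k = expi (k%:R * x).
Proof.
elim: k => [|k IH]; first by rewrite expr0 mul0r expi0.
by rewrite exprS IH -expiD -natr1 mulrDl mul1r addrC.
Qed.

Lemma expi2pi : expi (2 * pi : R) = 1.
Proof. by rewrite mulr_natl /expi cos2pi sin2pi. Qed.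

Lemma expi_neq1 (x : R) : 0 < `|x| < 2 * pi -> expi x != 1.
Proof.
move=> /andP[x0 x2]; apply/eqP => -[cx _].
have s0 : 0 < sin (`|x| / 2).
  by apply: sin_gt0_pi; apply/andP; split; lra.
have := cos_mulr2n (`|x| / 2); rewrite -[_ *+ 2]mulr_natr divfK// cos_norm cx cos2sin2.
have := exprn_gt0 2 s0; lra.
Qed.

Section discrete.
Variable N : nat.
Hypothesis N_gt0 : (0 < N)%N.

Let N_gt0R : 0 < N%:R :> R. Proof. by rewrite ltr0n. Qed.
Let N_neq0 : N%:R != 0 :> R. Proof. by rewrite gt_eqF. Qed.

Lemma omegaN : omega N ^+ N = 1 :> R[i].
Proof. by rewrite /omega expiX mulrC divfK// expi2pi. Qed.

Lemma omegaX l : omega N ^+ l = expi (theta N l) :> R[i].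
Proof. by rewrite /omega expiX /theta; congr expi; rewrite mulrCA mulrA. Qed.

Lemma omegaXM m l : omega N ^+ (m * l) = expi (m%:R * theta N l) :> R[i].
Proof. by rewrite mulnC exprM omegaX expiX. Qed.

Lemma omegaX_opp l : omega N ^+ (N.-1 * l) = expi (- theta N l) :> R[i].
Proof.
have h : omega N ^+ l * omega N ^+ (N.-1 * l) = 1 :> R[i].
  by rewrite -exprD -mulSn prednK// exprM omegaN expr1n.
have o0 : omega N ^+ l != 0 :> R[i].
  by apply/eqP => o; move: h; rewrite o mul0r => /esym/eqP; rewrite oner_eq0.
apply: (mulfI o0); rewrite h omegaX -expiD.
by rewrite (_ : _ + _ = 0) ?expi0// /theta; ring.
Qed.

Lemma theta_period (l : int) : theta N (l + N%:Z) = theta N l + 2 * pi :> R.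
Proof.
have N0 : N%:R != 0 :> R by rewrite pnatr_eq0 -lt0n.
by rewrite /theta intrD; field.
Qed.

Lemma expi_theta_period (l : int) k :
  expi (k%:R * theta N (l + N%:Z)) = expi (k%:R * theta N l) :> R[i].
Proof. by rewrite theta_period mulrDr expiD -[expi (_ * (2 * _))]expiX expi2pi expr1n mulr1. Qed.

Lemma thetaB (a b : int) : theta N (a - b) = theta N a - theta N b :> R.
Proof. by rewrite /theta intrB; ring. Qed.

(** Orthogonality of the characters of Z/N, on which the inversion of the
    discrete Fourier transform rests. *)
Lemma sum_expi_theta (a b : nat) : (a < N)%N -> (b < N)%N ->
  \sum_(m < N) expi (m%:R * theta N (a%:Z - b%:Z)) = (N%:R * (a == b)%:R : R[i]).
Proof.
move=> aN bN; under eq_bigr do rewrite -expiX.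
have [->|ab] := eqVneq a b.
  rewrite subrr /theta mulr0 mul0r expi0.
  under eq_bigr do rewrite expr1n.
  by rewrite sumr_const card_ord mulr1.
rewrite mulr0; set z := expi _.
have z1 : z - 1 != 0.
  rewrite subr_eq0; apply: expi_neq1.
  have p0 := @pi_gt0 R.
  have n0 : 0 < `|a%:Z - b%:Z|%:~R :> R by rewrite ltr0z; lia.
  have nN : `|a%:Z - b%:Z|%:~R < N%:R :> R by rewrite -[N%:R]/(N%:~R) ltr_int; lia.
  rewrite /theta normrM normfV (gtr0_norm N_gt0R) normrM ger0_norm ?mulr_ge0 ?ltW//.
  rewrite -intr_norm divr_gt0 ?mulr_gt0//= ltr_pdivrMr// ltr_pM2l ?mulr_gt0//.
apply: (mulfI z1); rewrite mulr0 -subrX1 /z expiX.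
rewrite [N%:R * _]mulrC /theta divfK// -[2 * pi * _]mulrC.
have expi_int (n : int) : expi (n%:~R * (2 * pi)) = 1 :> R[i].
  case: n => n; first by rewrite -pmulrn -expiX expi2pi expr1n.
  have : expi (n.+1%:R * (2 * pi)) = 1 :> R[i] by rewrite -expiX expi2pi expr1n.
  rewrite NegzE mulrNz mulNr /expi cosN sinN => -[-> ->].
  by rewrite oppr0.
by rewrite expi_int subrr.
Qed.

(** The complex number cosh(t + i phi). *)
Definition cosh_node (phi t : R) : R[i] :=
  (cos phi * coshR t) +i* (sin phi * sinhR t).

Lemma cosh_nodeE l t : cosh_node (theta N (Posz l)) t =
  (expR t / 2)%:C * omega N ^+ l + (expR (- t) / 2)%:C * omega N ^+ (N.-1 * l).
Proof.
rewrite omegaX omegaX_opp /cosh_node /expi /coshR /sinhR cosN sinN.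
by apply/eqP; rewrite eq_complex /=; apply/andP; split; apply/eqP; ring.
Qed.

Lemma cos_theta_mul l m : (2 * cos (m%:R * theta N (Posz l)))%:C =
  omega N ^+ (m * l) + omega N ^+ (N.-1 * m * l) :> R[i].
Proof.
rewrite -mulnA [(m * l)%N]mulnC mulnA ![omega N ^+ (_ * m)]exprM.
rewrite omegaX omegaX_opp !expiX mulrN /expi cosN sinN.
by apply/eqP; rewrite eq_complex /=; apply/andP; split; apply/eqP; ring.
Qed.

Lemma cosh_node_sum e m t :
  2 * Re (\sum_(l < N) (cos (m%:R * theta N (Posz l)))%:C *
     cosh_node (theta N (Posz l)) t ^+ e) =
  Re (\sum_(l < N) omega N ^+ (m * l) * cosh_node (theta N (Posz l)) t ^+ e) +
  Re (\sum_(l < N) omega N ^+ (N.-1 * m * l) * cosh_node (theta N (Posz l)) t ^+ e).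
Proof.
have ReD (x y : R[i]) : Re x + Re y = Re (x + y) by case: x y => ? ? [].
have Re2 (x : R[i]) : 2 * Re x = Re (2%:C * x) by case: x => ? ?/=; rewrite mul0r subr0.
rewrite ReD Re2 mulr_sumr -big_split/=; congr Re; apply: eq_bigr => l _.
by rewrite mulrA -rmorphM/= cos_theta_mul mulrDl.
Qed.

Lemma Re_ge0 (x : R[i]) : 0 <= x -> 0 <= Re x.
Proof. by rewrite lecE => /andP[]. Qed.

Lemma Re_gt0 (x : R[i]) : 0 < x -> 0 < Re x.
Proof. by rewrite ltcE => /andP[]. Qed.

Lemma cosh_node_sum_ge0 e m t :
  0 <= Re (\sum_(l < N) (cos (m%:R * theta N (Posz l)))%:C *
     cosh_node (theta N (Posz l)) t ^+ e).
Proof.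
rewrite -(pmulr_rge0 _ (ltr0n R 2)) cosh_node_sum.
under eq_bigr do rewrite cosh_nodeE.
under [X in _ + Re X]eq_bigr do rewrite cosh_nodeE.
by rewrite addr_ge0// Re_ge0// unity_power_sum_ge0// ?omegaN// ler0c divr_ge0 ?expR_ge0.
Qed.

Lemma cosh_node_sum_gt0 e m t : (m + e = N)%N ->
  0 < Re (\sum_(l < N) (cos (m%:R * theta N (Posz l)))%:C *
     cosh_node (theta N (Posz l)) t ^+ e).
Proof.
move=> meN; rewrite -(pmulr_rgt0 _ (ltr0n R 2)) cosh_node_sum.
under eq_bigr do rewrite cosh_nodeE.
under [X in _ + Re X]eq_bigr do rewrite cosh_nodeE.
have p0 : 0 < (expR t / 2)%:C :> R[i] by rewrite ltcR divr_gt0 ?expR_gt0.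
have q0 : 0 <= (expR (- t) / 2)%:C :> R[i] by rewrite ler0c divr_ge0 ?expR_ge0.
rewrite ltr_pwDl//.
  by rewrite Re_gt0// unity_power_sum_gt0// ?omegaN// ltW.
by rewrite Re_ge0// unity_power_sum_ge0// ?omegaN// ltW.
Qed.

(** All Taylor coefficients in a are nonnegative, and the one that involves the
    power N - m of the nodes is positive. *)
Lemma cosh_node_expsum_gt0 (a : R) m t : 0 < a -> (m < N)%N ->
  0 < Re (\sum_(l < N) (cos (m%:R * theta N (Posz l)))%:C *
     cosh_node (theta N (Posz l)) t * cexp (a%:C * cosh_node (theta N (Posz l)) t)).
Proof.
move=> a0 mN; pose j := (N - m.+1)%N.
have h e : \sum_(l < N) (cos (m%:R * theta N (Posz l)))%:C *
     cosh_node (theta N (Posz l)) t * cosh_node (theta N (Posz l)) t ^+ e =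
   \sum_(l < N) (cos (m%:R * theta N (Posz l)))%:C *
     cosh_node (theta N (Posz l)) t ^+ e.+1.
  by apply: eq_bigr => l _; rewrite exprS mulrA.
apply: lt_le_trans (@Re_expsum_ge R N (fun l => (cos (m%:R * theta N (Posz l)))%:C *
     cosh_node (theta N (Posz l)) t) (fun l => cosh_node (theta N (Posz l)) t)
     a j (ltW a0) _).
  rewrite h mulr_gt0//.
    by apply: cosh_node_sum_gt0; rewrite /j; lia.
  by rewrite divr_gt0 ?exprn_gt0// ltr0n fact_gt0.
by move=> k; rewrite h cosh_node_sum_ge0.
Qed.

End discrete.
End roots_of_unity.

(** * Positivity of the eigenvalues *)

Section eigenvalues.
Local Open Scope complex_scope.
Context {R : realType}.
Local Notation mu := (@lebesgue_measure R).
Local Notation Re := (@complex.Re R).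
Local Notation Im := (@complex.Im R).
Variables (alpha r rho : R).
Hypotheses (alpha_gt0 : 0 < alpha) (rI : 0 < r < rho).

Lemma c_ray_coef N l : c alpha r rho N l = ray_coef alpha rho (theta N l) r.
Proof. by []. Qed.

Lemma ray_coef_cos phi psi : cos phi = cos psi ->
  ray_coef alpha rho phi r = ray_coef alpha rho psi r.
Proof.
move=> e; rewrite /ray_coef !ray_distE.
have E x : (r - rho * cos x) ^+ 2 + (rho * sin x) ^+ 2 =
    (r - rho * cos x) ^+ 2 + rho ^+ 2 * (1 - cos x ^+ 2).
  by rewrite exprMn sin2cos2.
by rewrite !E e.
Qed.

(** Here - X cosh t + i Y sinh t is split as
    - alpha rho cosh t + alpha r cosh(t + i phi). *)
Lemma cart_dkernel_ray phi t :
  cart_dkernel (alpha * (rho - r * cos phi)) (alpha * (r * sin phi))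
    (- (alpha * cos phi)) (alpha * sin phi) t =
  alpha * expR (- (alpha * rho * coshR t)) *
    Re (cosh_node phi t * cexp ((alpha * r)%:C * cosh_node phi t)).
Proof.
rewrite /cart_dkernel /cosh_node /cexp /expi.
have -> : - (alpha * (rho - r * cos phi) * coshR t) =
  - (alpha * rho * coshR t) + alpha * r * (cos phi * coshR t) by ring.
rewrite expRD.
have -> : alpha * (r * sin phi) * sinhR t = alpha * r * (sin phi * sinhR t) by ring.
move: (coshR t) (sinhR t) => ch sh.
by rewrite /= !mul0r !subr0 !addr0; ring.
Qed.

Section fixed_order.
Variables (N m : nat).
Hypotheses (N_gt0 : (0 < N)%N).

Lemma Re_f : Re (f alpha r rho N (omega N ^+ m)) =
  \sum_(l < N) c alpha r rho N l * cos (m%:R * theta N (Posz l)).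
Proof.
rewrite /f big_mkord (raddf_sum (@complex.Re R : Rcomplex R -> R)).
apply: eq_bigr => l _; rewrite -exprM omegaXM// /expi /=.
by rewrite mul0r subr0.
Qed.

Lemma Im_f : Im (f alpha r rho N (omega N ^+ m)) =
  \sum_(0 <= l < N) c alpha r rho N l * sin (m%:R * theta N (Posz l)).
Proof.
rewrite /f !big_mkord (raddf_sum (@complex.Im R : Rcomplex R -> R)).
apply: eq_bigr => l _; rewrite -exprM omegaXM// /expi /=.
by rewrite mul0r addr0.
Qed.

Lemma c_period (l : int) : c alpha r rho N (l + N%:Z) = c alpha r rho N l.
Proof.
rewrite !c_ray_coef; apply: ray_coef_cos.
by have [] := @expi_theta_period R _ N_gt0 l 1; rewrite !mul1r.
Qed.

Lemma c_opp (l : int) : c alpha r rho N (- l) = c alpha r rho N l.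
Proof.
rewrite !c_ray_coef; apply: ray_coef_cos.
by rewrite (_ : theta N (- l) = - theta N l) ?cosN// /theta intrN; ring.
Qed.

(** The reflection l -> N - l fixes c_l and changes the sign of
    sin(m theta_l). *)
Lemma f_real : Im (f alpha r rho N (omega N ^+ m)) = 0.
Proof.
rewrite Im_f; pose g (l : nat) := c alpha r rho N l * sin (m%:R * theta N (Posz l)).
have gN l : (l <= N)%N -> g (N - l)%N = - g l.
  move=> lN; rewrite /g -subzn// -[X in X - _]add0r addrAC sub0r c_period c_opp.
  have [_ ->] := @expi_theta_period R _ N_gt0 (- l%:Z) m.
  rewrite (_ : m%:R * theta N (- l%:Z) = - (m%:R * theta N l)).
    by rewrite sinN mulrN.
  by rewrite /theta intrN; ring.
have g0 : g 0%N = 0 by rewrite /g /theta mulr0 mul0r mulr0 sin0 mulr0.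
have gNN : g N = 0 by have := gN 0%N isT; rewrite subn0 g0 oppr0.
have e1 : \sum_(0 <= l < N) g l = - \sum_(0 <= l < N) g l.+1.
  rewrite big_nat_rev /= -sumrN; apply: eq_big_nat => l /andP[_ lN].
  by rewrite add0n gN.
have e2 : \sum_(0 <= l < N) g l.+1 = \sum_(0 <= l < N) g l.
  have : \sum_(0 <= l < N.+1) g l = g 0%N + \sum_(0 <= l < N) g l.+1.
    by rewrite big_nat_recl.
  by rewrite big_nat_recr//= gNN g0 addr0 add0r => <-.
by move: e1; rewrite e2 -/g => e; lra.
Qed.

Lemma f_gt0 : (m < N)%N -> 0 < f alpha r rho N (omega N ^+ m).
Proof.
move=> mN; rewrite ltcE f_real eqxx /= Re_f.
have /andP[r0 rr] := rI.
pose D (l : nat) t := cos (m%:R * theta N (Posz l)) *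
  cart_dkernel (alpha * (rho - r * cos (theta N l))) (alpha * (r * sin (theta N l)))
    (- (alpha * cos (theta N l))) (alpha * sin (theta N l)) t.
have mD : measurable (`[0, +oo[ : set (measurableTypeR R)).
  exact: measurable_itv.
have iK (l : nat) : mu.-integrable `[0, +oo[ (EFin \o
    cart_dkernel (alpha * (rho - r * cos (theta N l))) (alpha * (r * sin (theta N l)))
    (- (alpha * cos (theta N l))) (alpha * sin (theta N l))).
  apply: integrable_cart_dkernel; rewrite mulr_gt0// subr_gt0 (le_lt_trans _ rr)//.
  by rewrite ler_piMr ?cos_le1// ltW.
have iD (l : nat) : mu.-integrable `[0, +oo[ (EFin \o D l).
  by have := integrableZl mD (cos (m%:R * theta N (Posz l))) (iK l).
have -> : \sum_(l < N) c alpha r rho N l * cos (m%:R * theta N (Posz l)) =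
    \sum_(l < N) \int[mu]_(t in `[0, +oo[) D l t.
  apply: eq_bigr => l _.
  by rewrite c_ray_coef (ray_coef_integral alpha_gt0 _ rI) mulrC -RintegralZl.
have [iS <-] := Rintegral_sum (fun l : 'I_N => iD l).
apply: Rintegral_pinfty_gt0 => // t t0.
under eq_bigr do rewrite /D cart_dkernel_ray mulrCA.
rewrite -mulr_sumr mulr_gt0// ?mulr_gt0 ?expR_gt0//.
have := cosh_node_expsum_gt0 N_gt0 t (mulr_gt0 alpha_gt0 r0) mN.
rewrite (raddf_sum (@complex.Re R : Rcomplex R -> R)).
congr (_ < _); apply: eq_bigr => l _.
have E (x : R) (y z : R[i]) : Re (x%:C * y * z) = x * Re (y * z).
  by case: y z => [? ?] [? ?] /=; ring.
exact: E.
Qed.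

End fixed_order.
End eigenvalues.

(** * The circulant system *)

Section system.
Local Open Scope complex_scope.
Context {R : realType}.

Lemma sum_int_shift (V : zmodType) (H : int -> V) (N k : nat) :
  (forall n : int, H (n + N%:Z) = H n) ->
  \sum_(0 <= i < N) H (i%:Z - k%:Z) = \sum_(0 <= i < N) H i%:Z.
Proof.
move=> HN; elim: k => [|k IH].
  by apply: eq_bigr => i _; rewrite subr0.
rewrite -IH; pose K i := H (i%:Z - k.+1%:Z).
have -> : \sum_(0 <= i < N) H (i%:Z - k%:Z) = \sum_(0 <= i < N) K i.+1.
  by apply: eq_bigr => i _; rewrite /K; congr H; lia.
have : \sum_(0 <= i < N.+1) K i = K 0%N + \sum_(0 <= i < N) K i.+1.
  by rewrite big_nat_recl.
have KN : K N = K 0%N by rewrite /K addrC HN sub0r.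
by rewrite big_nat_recr//= KN addrC => /addrI.
Qed.

Variables (alpha r rho : R) (N : nat).
Hypotheses (alpha_gt0 : 0 < alpha) (rI : 0 < r < rho) (N_gt0 : (0 < N)%N).

(** Coefficients act as row vectors on the left, so k indexes the charge points
    and i the collocation points; the common shift of both indices by one
    cancels in i - k. *)
Definition coef_mx : 'M[R]_N := \matrix_(k < N, i < N) c alpha r rho N (i%:Z - k%:Z).

(** The convolution theorem for the discrete Fourier transform. *)
Lemma coef_mx_DFT (Q : 'rV[R]_N) (m : nat) :
  \sum_(i < N) ((Q *m coef_mx) 0 i)%:C * omega N ^+ (m * i) =
  (\sum_(k < N) (Q 0 k)%:C * omega N ^+ (m * k)) * f alpha r rho N (omega N ^+ m).
Proof.
pose H (n : int) : R[i] := (c alpha r rho N n)%:C * expi (m%:R * theta N n).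
have HN (n : int) : H (n + N%:Z) = H n.
  by rewrite /H c_period// expi_theta_period.
have fE : f alpha r rho N (omega N ^+ m) = \sum_(0 <= l < N) H l%:Z.
  by rewrite /f; apply: eq_bigr => l _; rewrite -exprM omegaXM.
rewrite mulr_suml.
under eq_bigr do rewrite mxE rmorph_sum /= mulr_suml.
rewrite exchange_big /=; apply: eq_bigr => k _.
rewrite fE -(sum_int_shift k HN) big_mkord mulr_sumr; apply: eq_bigr => i _.
rewrite /coef_mx mxE rmorphM /= /H !omegaXM//.
have -> : theta N i = theta N k + theta N (i%:Z - k%:Z) :> R.
  by rewrite thetaB; ring.
by rewrite mulrDr expiD; ring.
Qed.

(** If the system annihilates Q, all its Fourier coefficients vanish because
    every f(omega^m) is nonzero; Fourier inversion then gives Q = 0. *)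
Lemma coef_mx_unit : coef_mx \in unitmx.
Proof.
rewrite -row_free_unit; apply: inj_row_free => Q QA.
have dft m : (m < N)%N -> \sum_(k < N) (Q 0 k)%:C * omega N ^+ (m * k) = 0 :> R[i].
  move=> mN; have := coef_mx_DFT Q m.
  under eq_bigr do rewrite QA mxE mul0r.
  rewrite big1// => /esym/eqP.
  rewrite mulf_eq0 (gt_eqF (f_gt0 alpha_gt0 rI N_gt0 mN)) orbF => /eqP //.
apply/rowP => k0; rewrite mxE.
have : \sum_(m < N) (\sum_(k < N) (Q 0 k)%:C * omega N ^+ (m * k)) *
    expi (m%:R * - theta N k0) = (N%:R * Q 0 k0)%:C.
  under eq_bigr do rewrite mulr_suml.
  rewrite exchange_big /= (bigD1 k0)//= [X in _ + X]big1 => [|k kk0].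
    rewrite addr0; under eq_bigr do rewrite omegaXM// -mulrA -expiD -mulrDr -thetaB.
    rewrite -mulr_sumr sum_expi_theta// eqxx mulr1 rmorphM/= mulrC.
    by rewrite rmorph_nat.
  rewrite -val_eqE /= in kk0.
  under eq_bigr do rewrite omegaXM// -mulrA -expiD -mulrDr -thetaB.
  by rewrite -mulr_sumr sum_expi_theta// (negPf kk0) !mulr0.
rewrite big1 => [|m _]; last by rewrite dft ?mul0r.
by move=> [] /esym/eqP; rewrite mulf_eq0 pnatr_eq0 -[N == 0%N]leqn0 leqNgt N_gt0 => /eqP.
Qed.

(** Turning the picture by - theta_j puts the j-th collocation point on the
    positive real axis, where moving along the outward normal means changing
    the radius. *)
Lemma normal_derivative_approx_sol (Q : 'rV[R]_N) (j : 'I_N) :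
  is_normal_derivative (approx_sol alpha rho Q) (colloc_pt r N j.+1)
    ((Q *m coef_mx) 0 j).
Proof.
have /andP[r0 rr] := rI.
have nw : `|omega N| = 1 :> R[i].
  by rewrite normc_def /omega /expi /= cos2Dsin2 sqrtr1.
have n0 : omega N ^+ j.+1 != 0 :> R[i].
  by rewrite -normr_eq0 normrX nw expr1n oner_eq0.
have dir : colloc_pt r N j.+1 / `|colloc_pt r N j.+1| = omega N ^+ j.+1.
  rewrite /colloc_pt normrM normrX nw expr1n mulr1 ger0_norm ?ler0c ?(ltW r0)//.
  by rewrite mulrC mulKf//; apply/eqP => -[/eqP]; rewrite gt_eqF.
have dist (k : 'I_N) t : normc (colloc_pt r N j.+1 + t%:C * omega N ^+ j.+1
     - charge_pt rho N k.+1) = ray_dist rho (theta N (j%:Z - k%:Z)) (r + t).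
  have -> : colloc_pt r N j.+1 + t%:C * omega N ^+ j.+1 - charge_pt rho N k.+1 =
      omega N ^+ j.+1 * ((r + t)%:C - rho%:C * expi (- theta N (j%:Z - k%:Z))).
    rewrite /colloc_pt /charge_pt rmorphD /= mulrBr mulrDr.
    rewrite mulrCA [_ * expi _]mulrC !omegaX//.
    rewrite (_ : theta N k.+1 = theta N j.+1 - theta N (j%:Z - k%:Z)); last first.
      by rewrite -thetaB; congr theta; lia.
    by rewrite expiD; ring.
  have nw1 : normc (omega N) = 1 :> R by rewrite /omega /expi /= cos2Dsin2 sqrtr1.
  by rewrite ComplexField.Normc.normcM normcX nw1 expr1n mul1r.
rewrite /is_normal_derivative dir /approx_sol.
have -> : (fun t : R => \sum_(k < N) Q 0 k * besselK 0 (alpha *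
     normc (colloc_pt r N j.+1 + t%:C * omega N ^+ j.+1 - charge_pt rho N k.+1)))
  = \sum_(k < N) (fun t : R => Q 0 k *
     besselK 0 (alpha * ray_dist rho (theta N (j%:Z - k%:Z)) (r + t))).
  by apply: funext => t; rewrite fct_sumE; apply: eq_bigr => k _; rewrite dist.
rewrite mxE; apply: is_derive_sum => k.
rewrite mxE c_ray_coef.
have d1 := is_derive_ray alpha_gt0 (theta N (j%:Z - k%:Z)) rI.
have ds : is_derive (0 : R) 1 (fun t : R => r + t) 1.
  by apply: is_derive_eq; rewrite add0r mulr1.
have d2 : is_derive (r + 0) 1
    (fun s => besselK 0 (alpha * ray_dist rho (theta N (j%:Z - k%:Z)) s))
    (ray_coef alpha rho (theta N (j%:Z - k%:Z)) r) by rewrite addr0.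
have := @is_derive1_comp _
  (fun s => besselK 0 (alpha * ray_dist rho (theta N (j%:Z - k%:Z)) s))
  (fun t => r + t) 0 _ _ d2 ds; rewrite mulr1 => d3.
by apply: is_derive_eq; rewrite /GRing.scale /=; ring.
Qed.

Lemma normal_derivative_system (Q : 'rV[R]_N) (s : R[i] -> R) :
  (forall j, (1 <= j <= N)%N ->
    is_normal_derivative (approx_sol alpha rho Q) (colloc_pt r N j)
      (s (colloc_pt r N j))) <->
  Q *m coef_mx = \row_(j < N) s (colloc_pt r N j.+1).
Proof.
split=> [dQ|QA j].
  apply/rowP => j; rewrite [RHS]mxE.
  (* both numbers are the derivative of the same function *)
  have [_ <-] := normal_derivative_approx_sol Q j.
  by have [_ <-] := dQ j.+1 (ltn_ord j).
case: j => // j /= jN.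
have := normal_derivative_approx_sol Q (Ordinal jN).
by rewrite QA mxE.
Qed.

End system.

Theorem theorem2p4 (R : realType) (alpha r rho : R)
    (alpha_gt0 : 0 < alpha) (r_gt0 : 0 < r) (r_lt_rho : r < rho)
    (rho_large :
       Num.sqrt (4 * alpha ^+ 2 * r ^+ 2 + 6
                 - 2 * Num.sqrt (4 * alpha ^+ 2 * r ^+ 2 + 9)) / alpha < rho) :
  forall N : nat, (0 < N)%N ->
    (forall m : nat, (m < N)%N -> 0 < f alpha r rho N (omega N ^+ m)) /\
    (forall s : R[i] -> R,
      exists! Q : 'rV[R]_N,
        forall j : nat, (1 <= j <= N)%N ->
          is_normal_derivative (approx_sol alpha rho Q) (colloc_pt r N j)
            (s (colloc_pt r N j))).
Proof.
move=> N N_gt0; have rI : 0 < r < rho by rewrite r_gt0.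
have Au := coef_mx_unit alpha_gt0 rI N_gt0.
split=> [m mN|s]; first exact: f_gt0.
exists ((\row_(j < N) s (colloc_pt r N j.+1)) *m invmx (coef_mx alpha r rho N)).
split.
  by apply/(normal_derivative_system alpha_gt0 rI N_gt0); rewrite mulmxKV.
move=> Q /(normal_derivative_system alpha_gt0 rI N_gt0) <-.
by rewrite mulmxK.
Qed.
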